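(* Let $\kappa \in \mathbb{R}$ and let $(X,d)$ be a geodesic metric space which is $\mathrm{CAT}(\kappa)$. Then $$D_{\kappa} \le m_{X} \le l_{X}.$$
   Context: **Geodesics.** A geodesic in a metric space $(X,d)$ is a map $\gamma\colon[0,c]\to X$ ($c\ge 0$) with $d(\gamma(s),\gamma(t))=|s-t|$ for all $s,t\in[0,c]$; it connects $\gamma(0)$ and $\gamma(c)$. $X$ is geodesic if every pair of points is connected by a geodesic. **$\mathrm{CAT}(\kappa)$.** Put $D_\kappa=\pi/\sqrt{\kappa}$ if $\kappa>0$ and $D_\kappa=+\infty$ if $\kappa\le 0$. Let $S_\kappa$ be the complete simply connected surface of constant curvature $\kappa$. A geodesic triangle $\Delta_{abc}$ in $X$ is a union $[a,b]\cup[b,c]\cup[c,a]$ of geodesics connecting three points pairwise. It is $\kappa$-small if $d(a,b)+d(b,c)+d(c,a)<2D_\kappa$. Its comparison triangle $\tilde\Delta_{abc}\subset S_\kappa$ is the geodesic triangle (unique up to congruence) with the same side lengths. The comparison point of $s\in[a,b]$ is the point $\tilde s\in[\tilde a,\tilde b]$ with $d(\tilde a,\tilde s)=d(a,s)$; similarly for the other sides. $X$ is $\mathrm{CAT}(\kappa)$ if for every $\kappa$-small geodesic triangle $\Delta_{abc}$ in $X$ and all $s,t\in\Delta_{abc}$ with comparison points $\tilde s,\tilde t$ one has $d(s,t)\le d_{S_\kappa}(\tilde s,\tilde t)$. **$m_X$.** A 4-cut in $X$ is a quadruple $(x_0,x_1,x_2,x_3)\in X^4$ such that $x_i\ne x_{i+1}$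 for $0\le i\le 2$; $d(x_i,x_{i+2})=d(x_i,x_{i+1})+d(x_{i+1},x_{i+2})$ for $i=0,1$; and $d(x_0,x_3)<\sum_{j=0}^{2}d(x_j,x_{j+1})$. Its length is $\sum_{j=0}^{2}d(x_j,x_{j+1})$. $m_X$ is the infimum of the lengths of 4-cuts in $X$. **$l_X$.** A continuous map $\gamma\colon[0,c]\to X$ is locally geodesic if every $t\in[0,c]$ has a neighborhood $U$ in $[0,c]$ such that $\gamma|_U$ is a geodesic. The length of a path $\gamma$ is $|\gamma|=\sup\sum_{i=0}^{n-1}d(\gamma(t_i),\gamma(t_{i+1}))$ over all partitions $0=t_0\le\cdots\le t_n=c$. $l_X$ is the infimum of the lengths of locally geodesic paths which are not geodesics. Infima over the empty set are $+\infty$. *)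

(* Defs.v *)
From HB Require Import structures.
From mathcomp Require Import all_boot all_order all_algebra.
From mathcomp Require Import all_classical all_reals.
From mathcomp Require Import ereal topology normedtype sequences exp trigo.

Set Implicit Arguments.
Unset Strict Implicit.
Unset Printing Implicit Defensive.

Import Order.TTheory GRing.Theory Num.Theory.
Import numFieldNormedType.Exports.

Local Open Scope classical_set_scope.
Local Open Scope ring_scope.

(* Everything on geodesics and triangles is stated for a bare distance function
   [d], so that it applies both to a [metricType] (through [mdist]) and to the
   model surfaces below. A path on [0, c] is a function on [R] of which only
   the values on [0, c] matter. *)
Section Geodesics.
Context {R : realType} {T : Type} (d : T -> T -> R).

Definition geodesic (c : R) (gamma : R -> T) : Prop :=
  0 <= c /\
  forall s t : R, s \in `[0, c] -> t \in `[0, c] ->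
    d (gamma s) (gamma t) = `|s - t|.

Definition connects (c : R) (gamma : R -> T) (x y : T) : Prop :=
  gamma 0 = x /\ gamma c = y.

Definition geodesic_space : Prop :=
  forall x y : T, exists (c : R) (gamma : R -> _), geodesic c gamma /\ connects c gamma x y.

Definition geodesic_segment (x y : T) (S : set T) : Prop :=
  exists (c : R) (gamma : R -> _),
    [/\ geodesic c gamma, connects c gamma x y & S = gamma @` `[0, c] ].

(* The triangle itself is the union of the three sides; they are kept apart
   because comparison points are defined side by side. *)
Record triangle : Type := Triangle {
  vtxa : T; vtxb : T; vtxc : T;
  sideab : set T; sidebc : set T; sideca : set T;
  sideabP : geodesic_segment vtxa vtxb sideab;
  sidebcP : geodesic_segment vtxb vtxc sidebc;
  sidecaP : geodesic_segment vtxc vtxa sideca }.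

Definition perimeter (D : triangle) : R :=
  d (vtxa D) (vtxb D) + d (vtxb D) (vtxc D) + d (vtxc D) (vtxa D).

End Geodesics.

Section Comparison.
Context {R : realType} {T T' : Type} (d : T -> T -> R) (d' : T' -> T' -> R).

Definition comparison_triangle (D : triangle d) (D' : triangle d') : Prop :=
  [/\ d' (vtxa D') (vtxb D') = d (vtxa D) (vtxb D),
      d' (vtxb D') (vtxc D') = d (vtxb D) (vtxc D) &
      d' (vtxc D') (vtxa D') = d (vtxc D) (vtxa D) ].

Definition comparison_point (D : triangle d) (D' : triangle d')
    (s : T) (s' : T') : Prop :=
  [\/ [/\ sideab D s, sideab D' s' & d' (vtxa D') s' = d (vtxa D) s],
      [/\ sidebc D s, sidebc D' s' & d' (vtxb D') s' = d (vtxb D) s] |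
      [/\ sideca D s, sideca D' s' & d' (vtxc D') s' = d (vtxc D) s] ].

End Comparison.

Record model_surface (R : realType) : Type := ModelSurface {
  surf_point :> Type;
  surf_dist : surf_point -> surf_point -> R }.

Section ModelSurfaces.
Context {R : realType}.

Definition dot3 (p q : 'rV[R]_3) : R := \sum_i p 0 i * q 0 i.

Definition lorentz3 (p q : 'rV[R]_3) : R :=
  - (p 0 0 * q 0 0) + p 0 1 * q 0 1 + p 0 2 * q 0 2.

(* inverse of cosh : [0, +oo[ -> [1, +oo[ *)
Definition arcosh (x : R) : R := ln (x + Num.sqrt (x ^+ 2 - 1)).

(* kappa > 0: unit sphere with its angular metric divided by sqrt kappa *)
Definition spherical_surface (kappa : R) : model_surface R :=
  @ModelSurface R {p : 'rV[R]_3 | dot3 p p == 1}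
    (fun p q => acos (dot3 (val p) (val q)) / Num.sqrt kappa).

(* The norm that the library puts on row vectors is the sup norm, hence the
   explicit Euclidean distance. *)
Definition euclidean_plane : model_surface R :=
  @ModelSurface R 'rV[R]_2
    (fun p q => Num.sqrt (\sum_i (p 0 i - q 0 i) ^+ 2)).

(* kappa < 0: upper sheet of the hyperboloid, with the hyperbolic metric of
   curvature -1 divided by sqrt (- kappa) *)
Definition hyperbolic_surface (kappa : R) : model_surface R :=
  @ModelSurface R {p : 'rV[R]_3 | (lorentz3 p p == -1) && (0 < p 0 0)}
    (fun p q => arcosh (- lorentz3 (val p) (val q)) / Num.sqrt (- kappa)).

Definition surface (kappa : R) : model_surface R :=
  if 0 < kappa then spherical_surface kappa
  else if kappa < 0 then hyperbolic_surface kappa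
  else euclidean_plane.

Definition diam_surface (kappa : R) : \bar R :=
  if 0 < kappa then (pi / Num.sqrt kappa)%:E else +oo%E.

End ModelSurfaces.

Section MetricInvariants.
Context {R : realType} (X : metricType R).

Definition CAT (kappa : R) : Prop :=
  forall D : triangle (@mdist R X),
    ((perimeter D)%:E < 2%:E * diam_surface kappa)%E ->
  forall D' : triangle (@surf_dist R (surface kappa)),
    comparison_triangle D D' ->
  forall (s t : X) (s' t' : surface kappa),
    comparison_point D D' s s' -> comparison_point D D' t t' ->
    mdist s t <= surf_dist s' t'.

Definition four_cut_length (x0 x1 x2 x3 : X) : R :=
  mdist x0 x1 + mdist x1 x2 + mdist x2 x3.

Definition four_cut (x0 x1 x2 x3 : X) : Prop :=
  [/\ [/\ x0 <> x1, x1 <> x2 & x2 <> x3],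
      mdist x0 x2 = mdist x0 x1 + mdist x1 x2,
      mdist x1 x3 = mdist x1 x2 + mdist x2 x3 &
      mdist x0 x3 < four_cut_length x0 x1 x2 x3 ].

Definition m_inf : \bar R :=
  ereal_inf [set L | exists x0 x1 x2 x3,
    four_cut x0 x1 x2 x3 /\ L = (four_cut_length x0 x1 x2 x3)%:E].

Definition locally_geodesic (c : R) (gamma : R -> X) : Prop :=
  {within `[0, c], continuous gamma} /\
  forall t : R, t \in `[0, c] -> exists2 U : set R, nbhs t U &
    forall s u : R, s \in `[0, c] -> u \in `[0, c] -> U s -> U u ->
      mdist (gamma s) (gamma u) = `|s - u|.

Definition path_length (c : R) (gamma : R -> X) : \bar R :=
  ereal_sup [set L | exists (n : nat) (t : nat -> R),
    [/\ t 0%N = 0, t n = c, forall i, (i < n)%N -> t i <= t i.+1 &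
        L = (\sum_(i < n) mdist (gamma (t i)) (gamma (t i.+1)))%:E] ].

Definition l_inf : \bar R :=
  ereal_inf [set L | exists (c : R) (gamma : R -> _),
    [/\ 0 <= c, locally_geodesic c gamma,
        ~ geodesic (@mdist R X) c gamma & L = path_length c gamma] ].

End MetricInvariants.

(* Main.v *)
Require Import Defs.
From mathcomp Require Import all_boot all_order all_algebra.
From mathcomp Require Import all_classical all_reals.
From mathcomp Require Import ereal topology normedtype sequences exp trigo.
From mathcomp Require Import ring lra.

(** Two independent arguments give the two inequalities.

    The inequality m_X <= l_X holds in every metric space. A local geodesic on
    [0, c] is, by compactness, geodesic on all subintervals of length at most
    some r > 0. On an interval [s, t] whose length is between r and 2 r, the
    points at times s, t - r, s + r, t have all the equalities required of a
    4-cut; so either they form one, of length t - s <= c, or the curve is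
    geodesic on [s, t] too. Without a 4-cut of length at most c the scale can
    therefore be enlarged until the whole curve is geodesic
    ([locally_geodesic_four_cut]). As the path has length at least c, a local
    geodesic that is not a geodesic yields a 4-cut which is not longer than it.

    For D_kappa <= m_X, a 4-cut x0, x1, x2, x3 shorter than D_kappa would give
    a kappa-small triangle x0 x2 x3 whose side [x0, x2] may be taken through
    x1. Its angle at x2 is not flat in the model surface, since
    d(x0, x3) < d(x0, x2) + d(x2, x3). Hence neither is the angle at x2 of the
    smaller triangle with vertices the comparison points of x1, x2, x3, so that
    d(x1, x3) = d(x1, x2) + d(x2, x3) strictly exceeds the comparison distance,
    against CAT(kappa). What this uses of the surface is called
    [strict_hinges]: triangles with prescribed sides exist, and a triangle
    inequality that is strict for a hinge remains strict after one arm is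
    shortened.

    The sphere and the hyperbolic plane are treated together: both are level
    sets of a quadratic form, with distances read off a bilinear form B through
    a generalized cosine C and sine S that satisfy
    C^2 + eps S^2 = 1, eps = 1 or -1. Geodesics are the combinations
    (S (x - t) p + S t q) / S x, and angles enter only through the law of
    cosines ([constant_curvature_strict_hinges]). In the Euclidean plane the
    same steps are direct computations. *)

Set Implicit Arguments.
Unset Strict Implicit.
Unset Printing Implicit Defensive.

Import Order.TTheory GRing.Theory Num.Theory.
Import numFieldNormedType.Exports.

Local Open Scope classical_set_scope.
Local Open Scope ring_scope.

(** * Local geodesics and 4-cuts *)

Section LocalGeodesics.
Context {R : realType} (X : metricType R).
Implicit Types (c r : R) (gamma : R -> X).

Definition geodesic_at_scale c gamma r : Prop :=
  forall s t : R, 0 <= s -> s <= t -> t <= c -> t - s <= r ->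
    mdist (gamma s) (gamma t) = t - s.

(** The scale r is a Lebesgue number for the neighborhoods on which the curve
    is geodesic. *)
Lemma locally_geodesic_at_scale c gamma : locally_geodesic c gamma ->
  exists2 r : R, 0 < r & geodesic_at_scale c gamma r.
Proof.
move=> [_ lg].
have /compact_near_coveringP cov := @segment_compact R 0 c.
pose P (r s : R) := forall t : R, t \in `[0, c] -> `|s - t| <= r ->
  s \in `[0, c] -> mdist (gamma s) (gamma t) = `|s - t|.
have /cov : forall s : R, `[0, c]%classic s ->
    \forall s' \near s & r \near 0^'+, P r s'.
  move=> s s0c; have [U /nbhs_ballP[e /= e0 eU] gU] := lg s s0c.
  exists (ball s (e / 2), [set r | r < e / 2]) => /=.
    split; first by apply: nbhsx_ballx; rewrite divr_gt0.
    by near=> r => /=; near: r; apply: nbhs_right_lt; rewrite divr_gt0.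
  move=> [s' r] /= [ss' re] t t0c s't s'0c; apply: gU => //; apply: eU.
    by apply: le_ball ss'; lra.
  rewrite /ball/= in ss' *.
  rewrite (_ : s - t = (s - s') + (s' - t)); last by ring.
  by apply: le_lt_trans (ler_normD _ _) _; lra.
move=> cov0; near (0 : R)^'+ => r; exists r => // s t s0 st tc tsr.
have s0c : s \in `[0, c] by rewrite in_itv/= s0 (le_trans st).
have t0c : t \in `[0, c] by rewrite in_itv/= (le_trans s0).
have sP : P r s by exact: (near cov0 r).
by rewrite sP// distrC ger0_norm ?subr_ge0.
Unshelve. all: by end_near. Qed.

(** The 4-cut that an interval of length between r and r + eta would produce
    consists of its two ends and the points at distance r from them; the
    condition eta < r keeps these four points in order and distinct. *)
Lemma geodesic_at_scale_extend c gamma r eta :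
    (forall x0 x1 x2 x3 : X,
      four_cut x0 x1 x2 x3 -> c < four_cut_length x0 x1 x2 x3) ->
    eta < r -> geodesic_at_scale c gamma r ->
  geodesic_at_scale c gamma (r + eta).
Proof.
move=> nocut er gr s t s0 st tc tsr.
have [tsr'|rts] := leP (t - s) r; first exact: gr.
pose h := t - s - r.
have d01 : mdist (gamma s) (gamma (s + h)) = h by rewrite gr /h//; lra.
have d12 : mdist (gamma (s + h)) (gamma (s + r)) = r - h.
  by rewrite gr /h//; lra.
have d23 : mdist (gamma (s + r)) (gamma t) = h by rewrite gr /h//; lra.
have d02 : mdist (gamma s) (gamma (s + r)) = r by rewrite gr//; lra.
have d13 : mdist (gamma (s + h)) (gamma t) = r by rewrite gr /h//; lra.
have len : four_cut_length (gamma s) (gamma (s + h)) (gamma (s + r)) (gamma t)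
    = t - s.
  by rewrite /four_cut_length d01 d12 d23 /h; ring.
apply/eqP; rewrite eq_le; apply/andP; split.
  rewrite -len /four_cut_length.
  rewrite (le_trans (metric_triangle _ (gamma (s + r)) _))//.
  by rewrite lerD2r metric_triangle.
rewrite leNgt; apply/negP => cut.
suff /nocut : four_cut (gamma s) (gamma (s + h)) (gamma (s + r)) (gamma t).
  by rewrite len; lra.
split; [split|..].
- by move=> e; move: d01; rewrite -e mdistxx /h; lra.
- by move=> e; move: d12; rewrite -e mdistxx /h; lra.
- by move=> e; move: d23; rewrite -e mdistxx /h; lra.
- by rewrite d01 d12 d02; ring.
- by rewrite d12 d23 d13; ring.
- by rewrite len.
Qed.

Lemma locally_geodesic_four_cut c gamma : 0 <= c ->
    locally_geodesic c gamma -> ~ geodesic (@mdist R X) c gamma ->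
  exists x0 x1 x2 x3 : X,
    four_cut x0 x1 x2 x3 /\ four_cut_length x0 x1 x2 x3 <= c.
Proof.
move=> c0 lg ng; apply: contrapT => nocut; apply: ng.
have {}nocut (x0 x1 x2 x3 : X) :
    four_cut x0 x1 x2 x3 -> c < four_cut_length x0 x1 x2 x3.
  by move=> cut; rewrite ltNge; apply/negP => le_c; apply: nocut;
    exists x0, x1, x2, x3.
have [r r0 gr] := locally_geodesic_at_scale lg.
(* The scale grows by the fixed amount r / 2 at each step, so it eventually
   exceeds c. *)
have grn n : geodesic_at_scale c gamma (r + r / 2 *+ n).
  elim: n => [|n IHn]; first by rewrite mulr0n addr0.
  rewrite mulrSr addrA; apply: geodesic_at_scale_extend => //.
  have : 0 <= r / 2 *+ n by rewrite mulrn_wge0// divr_ge0// ltW.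
  by lra.
have gc : geodesic_at_scale c gamma c.
  have nc : c <= r / 2 *+ Num.bound (c / (r / 2)).
    rewrite -mulr_natl -ler_pdivrMr ?divr_gt0//.
    by rewrite ltW// archi_boundP// divr_ge0// divr_ge0// ltW.
  by move=> s t s0 st tc tsc; apply: (grn (Num.bound (c / (r / 2)))) => //; lra.
split=> // s t; rewrite !in_itv/= => /andP[s0 sc] /andP[t0 tc].
wlog st : s t s0 sc t0 tc / s <= t.
  by move=> W; have [/W->//|/ltW/W] := leP s t; rewrite metric_sym distrC => ->.
by rewrite gc//; [rewrite distrC ger0_norm ?subr_ge0|lra].
Qed.

(** On a partition finer than the scale at which the curve is geodesic, the
    sum of distances is exactly c. *)
Lemma path_length_locally_geodesic c gamma : 0 <= c ->
  locally_geodesic c gamma -> (c%:E <= path_length c gamma)%E.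
Proof.
move=> c0 /locally_geodesic_at_scale[r r0 gr].
pose n := (Num.bound (c / r)).+1.
have n0 : 0 < n%:R :> R by rewrite ltr0n.
have step : c / n%:R <= r.
  rewrite ler_pdivrMr// mulrC -ler_pdivrMr//.
  rewrite (@le_trans _ _ (Num.bound (c / r))%:R) ?ler_nat ?leqnSn//.
  by rewrite ltW// archi_boundP// divr_ge0// ltW.
apply: ereal_sup_ubound; exists n, (fun i => c / n%:R * i%:R).
split.
- by rewrite mulr0.
- by rewrite divfK// gt_eqF.
- by move=> i _; rewrite ler_wpM2l ?ler_nat ?leqnSn ?divr_ge0// ltW.
- congr (_%:E).
  rewrite (eq_bigr (fun=> c / n%:R)); last first.
    move=> i _; rewrite gr.
    + by rewrite -mulrBr -natrB// subSnn mulr1.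
    + by rewrite mulr_ge0// divr_ge0// ltW.
    + by rewrite ler_wpM2l ?ler_nat ?leqnSn ?divr_ge0// ltW.
    + rewrite mulrAC ler_pdivrMr// ler_wpM2l// ler_nat; exact: ltn_ord.
    + by rewrite -mulrBr -natrB// subSnn mulr1.
  by rewrite sumr_const card_ord -[RHS]mulr_natr divfK// gt_eqF.
Qed.

Lemma m_inf_le_l_inf : (m_inf X <= l_inf X)%E.
Proof.
apply/ereal_infP => _ [c [gamma [c0 lg ng ->]]].
have [x0 [x1 [x2 [x3 [cut lec]]]]] := locally_geodesic_four_cut c0 lg ng.
apply: le_trans (path_length_locally_geodesic c0 lg).
apply: le_trans (_ : ((four_cut_length x0 x1 x2 x3)%:E <= _)%E).
  by apply: ereal_inf_lbound; exists x0, x1, x2, x3.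
by rewrite lee_fin.
Qed.

End LocalGeodesics.

(** * 4-cuts under curvature bounds *)

(** A form of the statement that local geodesics shorter than D are geodesics
    in M. The angle between the sides a + b and c of the triangle is not flat
    because e < a + b + c; the last inequality says that it is still not flat
    after the first of these sides is shortened to b. *)
Definition strict_hinges {R : realType} (M : model_surface R)
    (D : \bar R) : Prop :=
  forall a b c e : R, 0 < a -> 0 < b -> 0 < c -> 0 < e ->
    `|a + b - c| <= e -> e < a + b + c -> ((a + b + c)%:E < D)%E ->
  exists (D' : triangle (@surf_dist R M)) (s : M),
    [/\ surf_dist (vtxa D') (vtxb D') = a + b,
        surf_dist (vtxb D') (vtxc D') = c &
        surf_dist (vtxc D') (vtxa D') = e ] /\
    [/\ sideab D' s, surf_dist (vtxa D') s = a &
        surf_dist s (vtxc D') < b + c ].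

Lemma geodesic_segment_ends {R : realType} {T : Type} (d : T -> T -> R)
  (x y : T) (S : set T) : geodesic_segment d x y S -> S x /\ S y.
Proof.
move=> [c [gamma [[c0 _] [<- <-] ->]]].
by split; [exists 0|exists c] => //=; rewrite in_itv/= lexx c0.
Qed.

Section FourCuts.
Context {R : realType} (X : metricType R).

(** When the triangle inequality at y is an equality, geodesics from x to y and
    from y to z concatenate to a geodesic. *)
Lemma geodesic_segment_through (x y z : X) :
    geodesic_space (@mdist R X) -> mdist x z = mdist x y + mdist y z ->
  exists S, geodesic_segment (@mdist R X) x z S /\ S y.
Proof.
move=> gX xyz.
have [a [g [[a0 gg] [g0 ga]]]] := gX x y.
have [b [h [[b0 hh] [h0 hb]]]] := gX y z.
have dxy : mdist x y = a.
  by rewrite -g0 -ga gg ?in_itv/= ?lexx ?a0// distrC subr0 ger0_norm.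
have dyz : mdist y z = b.
  by rewrite -h0 -hb hh ?in_itv/= ?lexx ?b0// distrC subr0 ger0_norm.
pose k t := if t <= a then g t else h (t - a).
have k0 : k 0 = x by rewrite /k a0.
have ka : k a = y by rewrite /k lexx.
have kab : k (a + b) = z.
  rewrite /k; case: ifPn => [|_]; last by rewrite addrAC subrr add0r.
  rewrite gerDl => b_le0; have b_eq0 : b = 0 by lra.
  by rewrite -hb b_eq0 addr0 h0.
exists (k @` `[0, a + b]); split; last first.
  by exists a => //=; rewrite in_itv/= a0 lerDl.
exists (a + b), k; split=> //; split; first exact: addr_ge0.
move=> s t; rewrite !in_itv/= => /andP[s0 sab] /andP[t0 tab].
wlog st : s t s0 sab t0 tab / s <= t.
  by move=> W; have [/W->//|/ltW/W] := leP s t; rewrite metric_sym distrC => ->.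
rewrite (distrC s) (ger0_norm (_ : 0 <= t - s)) ?subr_ge0//.
rewrite /k; have [ta|at_] := leP t a.
  rewrite (le_trans st)// gg ?in_itv/= ?s0 ?t0 ?(le_trans st)//.
  by rewrite distrC ger0_norm ?subr_ge0.
have [sa|as_] := leP s a; last first.
  rewrite hh ?in_itv/=; [|lra|lra].
  by rewrite distrC ger0_norm; lra.
have d1 : mdist x (g s) = s.
  rewrite -g0 gg ?in_itv/= ?lexx ?s0 ?a0//.
  by rewrite distrC subr0 ger0_norm.
have d2 : mdist (g s) y = a - s.
  rewrite -ga gg ?in_itv/= ?lexx ?s0 ?a0//.
  by rewrite distrC ger0_norm ?subr_ge0.
have d3 : mdist y (h (t - a)) = t - a.
  rewrite -h0 hh ?in_itv/= ?lexx ?b0//; last by lra.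
  by rewrite distrC subr0 ger0_norm; lra.
have d4 : mdist (h (t - a)) z = a + b - t.
  rewrite -hb hh ?in_itv/= ?lexx ?b0//; last by lra.
  by rewrite distrC ger0_norm; lra.
have t1 := metric_triangle (g s) y (h (t - a)).
have t2 := metric_triangle x (g s) z.
have t3 := metric_triangle (g s) (h (t - a)) z.
apply/eqP; rewrite eq_le; apply/andP; split; lra.
Qed.

(** The triangle to compare has vertices x0, x2, x3, with x1 on the side
    [x0, x2]. *)
Lemma strict_hinges_le_m_inf (kappa : R) :
    geodesic_space (@mdist R X) -> CAT X kappa ->
    strict_hinges (surface kappa) (diam_surface kappa) ->
  (diam_surface kappa <= m_inf X)%E.
Proof.
move=> gX catX hinges.
apply/ereal_infP => _ [x0 [x1 [x2 [x3 [[[n01 n12 n23] d02 d13 cut] ->]]]]].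
rewrite leNgt; apply/negP => ltD; rewrite /four_cut_length in cut ltD.
have d01 : 0 < mdist x0 x1 by rewrite mdist_gt0; apply/eqP.
have d12 : 0 < mdist x1 x2 by rewrite mdist_gt0; apply/eqP.
have d23 : 0 < mdist x2 x3 by rewrite mdist_gt0; apply/eqP.
(* If x0 = x3, the two equalities of the 4-cut force d(x1, x2) = 0. *)
have d03 : 0 < mdist x0 x3.
  rewrite mdist_gt0; apply/eqP => x03.
  move: d12 d13; rewrite -x03 (metric_sym x1 x0) (metric_sym x2 x0) d02.
  by lra.
have tri : `|mdist x0 x1 + mdist x1 x2 - mdist x2 x3| <= mdist x0 x3.
  have := metric_triangle x0 x3 x2; have := metric_triangle x2 x0 x3.
  by rewrite (metric_sym x3) (metric_sym x2 x0) ler_norml => ? ?; lra.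
have [D' [s [[e1 e2 e3] [s_ab e4 e5]]]] :=
  hinges _ _ _ _ d01 d12 d23 d03 tri cut ltD.
have [S02 [S02P S02x1]] := geodesic_segment_through gX d02.
have seg y z : exists S, geodesic_segment (@mdist R X) y z S.
  by have [c [g [gg cg]]] := gX y z; exists (g @` `[0, c]), c, g.
have [[S23 S23P] [S30 S30P]] := (seg x2 x3, seg x3 x0).
suff : mdist x1 x3 <= surf_dist s (vtxc D') by rewrite d13; lra.
apply: (catX (Triangle S02P S23P S30P) _ D').
- pose L := mdist x0 x1 + mdist x1 x2 + mdist x2 x3.
  apply: (@lt_le_trans _ _ (2%:E * L%:E)%E).
    by rewrite -EFinM lte_fin /perimeter/= /L d02 (metric_sym x3 x0); lra.
  by rewrite lee_pmul2l ?lte_fin// ltW.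
- by split=> /=; [rewrite e1 d02|rewrite e2|rewrite e3 metric_sym].
- by apply: Or31; split.
- apply: Or32; split=> //=; first exact: (geodesic_segment_ends S23P).2.
  exact: (geodesic_segment_ends (sidebcP D')).2.
Qed.

End FourCuts.

(** * Hinges in surfaces of nonzero constant curvature *)

Section ConstantCurvature.
Context {R : realType} (M : model_surface R) (D : \bar R).
Context (eps : R) (C S arc : R -> R) (B : M -> M -> R).
(* The sphere has eps = 1 and C, S = cos, sin; the hyperbolic plane has
   eps = -1 and C, S = cosh, sinh; the arguments are rescaled according to the
   curvature. *)
Hypothesis eps2 : eps * eps = 1.
Hypothesis CD : forall x y, C (x + y) = C x * C y - eps * (S x * S y).
Hypothesis SD : forall x y, S (x + y) = S x * C y + C x * S y.
Hypothesis CN : forall x, C (- x) = C x.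
Hypothesis SN : forall x, S (- x) = - S x.
Hypothesis CS1 : forall x, C x ^+ 2 + eps * S x ^+ 2 = 1.
Hypothesis S_gt0 : forall x, 0 < x -> (x%:E < D)%E -> 0 < S x.
Hypothesis C_lt : forall x y,
  0 <= x -> x < y -> (y%:E < D)%E -> eps * C y < eps * C x.
Hypothesis distE : forall p q : M, surf_dist p q = arc (B p q).
Hypothesis arcK : forall x, 0 <= x -> (x%:E < D)%E -> arc (C x) = x.
Hypothesis arc_lt : forall p q y,
  0 < y -> (y%:E < D)%E -> eps * C y < eps * B p q -> arc (B p q) < y.
Hypothesis Bsym : forall p q, B p q = B q p.
Hypothesis Bpp : forall p, B p p = 1.
(* Nonnegative combinations suffice, and on the hyperboloid they are needed to
   stay on the upper sheet. *)
Hypothesis Bcomb : forall p q al be, 0 <= al -> 0 <= be ->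
    al ^+ 2 + be ^+ 2 + 2 * (al * be) * B p q = 1 ->
  exists r, forall z, B r z = al * B p z + be * B q z.
(* Hinges at q with arms x, y and an angle of cosine u. *)
Hypothesis Bframe : forall x y u, u ^+ 2 <= 1 -> exists p q r,
  [/\ B p q = C x, B q r = C y & B r p = C x * C y + eps * (S x * S y * u)].

Let lt_dom x y : x <= y -> (y%:E < D)%E -> (x%:E < D)%E.
Proof. by move=> xy; apply: le_lt_trans; rewrite lee_fin. Qed.

Let S0 : S 0 = 0.
Proof. by have := SN 0; rewrite oppr0 => ?; lra. Qed.

Let C0 : C 0 = 1.
Proof. by have := CS1 0; have := CD 0 0; rewrite addr0 !S0; lra. Qed.

Let S_ge0 x : 0 <= x -> (x%:E < D)%E -> 0 <= S x.
Proof. by rewrite le0r => /predU1P[->|/S_gt0 /[apply]/ltW//]; rewrite S0. Qed.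

Let C_le x y : 0 <= x -> x <= y -> (y%:E < D)%E -> eps * C y <= eps * C x.
Proof.
by move=> x0; rewrite le_eqVlt => /predU1P[->//|xy yD]; apply/ltW/C_lt.
Qed.

Let CB x y : C (x - y) = C x * C y + eps * (S x * S y).
Proof. by rewrite CD CN SN; ring. Qed.

Let SB x y : S (x - y) = S x * C y - C x * S y.
Proof. by rewrite SD CN SN; ring. Qed.

Let C_norm x : C `|x| = C x.
Proof. by have [_|_] := ler0P x. Qed.

(** The form of the two points at times s and t of the geodesic below, up to
    the factor S x ^+ 2; for s = t it says that these points lie on the
    surface. *)
Lemma form_interpolation x s t :
  S (x - s) * (S (x - t) + S t * C x) + S s * (S (x - t) * C x + S t)
  = S x ^+ 2 * C (s - t).
Proof.
rewrite !SB CB.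
have -> : S x ^+ 2 * (C s * C t + eps * (S s * S t)) =
  S x ^+ 2 * (C s * C t) + S s * S t * (C x ^+ 2 + eps * S x ^+ 2 - C x ^+ 2).
  by ring.
by rewrite CS1; ring.
Qed.

(** The geodesic is the arc that the plane of p and q cuts out on the level set
    of the form. The last clause is what later gives the distance from a point
    of a side to the opposite vertex. *)
Lemma form_geodesic p q x : 0 < x -> (x%:E < D)%E -> B p q = C x ->
  exists gamma : R -> M, [/\ geodesic (@surf_dist R M) x gamma,
    connects x gamma p q &
    forall t z, 0 <= t -> t <= x ->
      S x * B (gamma t) z = S (x - t) * B p z + S t * B q z].
Proof.
move=> x0 xD Bpq; have Sx := S_gt0 x0 xD.
(* The ends are chosen apart because the form alone does not tell that a point
   of the arc is equal to p or q. *)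
have /choice[gamma gammaP] : forall t, exists r, 0 <= t -> t <= x ->
    (forall z, S x * B r z = S (x - t) * B p z + S t * B q z) /\
    ((t = 0 -> r = p) /\ (t = x -> r = q)).
  move=> t; have [-> /=|t_neq0] := eqVneq t 0.
    exists p => _ _; split; first by move=> z; rewrite subr0 S0; ring.
    by split=> // xE; move: x0; rewrite -xE ltxx.
  have [-> /=|t_neqx] := eqVneq t x.
    exists q => _ _; split; first by move=> z; rewrite subrr S0; ring.
    by split=> // xE; move: x0; rewrite xE ltxx.
  have [t0|] := leP 0 t; last by exists p.
  have [tx|] := leP t x; last by exists p.
  have St : 0 <= S t by apply: S_ge0 => //; apply: lt_dom xD.
  have Sxt : 0 <= S (x - t).
    by apply: S_ge0; [lra | apply: lt_dom xD; lra].
  have [] := @Bcomb p q (S (x - t) / S x) (S t / S x).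
  - by rewrite divr_ge0// ltW.
  - by rewrite divr_ge0// ltW.
  - have := form_interpolation x t t; rewrite subrr C0 mulr1 Bpq => E.
    have -> : (S (x - t) / S x) ^+ 2 + (S t / S x) ^+ 2 +
      2 * (S (x - t) / S x * (S t / S x)) * C x =
      (S (x - t) * (S (x - t) + S t * C x) + S t * (S (x - t) * C x + S t)) /
      S x ^+ 2 by field; rewrite gt_eqF.
    by rewrite E divff// expf_neq0// gt_eqF.
  - move=> r rP; exists r => _ _; split; last first.
      by split=> tE; rewrite tE eqxx in t_neq0 t_neqx.
    by move=> z; rewrite rP; field; rewrite gt_eqF.
exists gamma; split.
- split; first exact: ltW.
  move=> s t; rewrite !in_itv/= => /andP[s0 sx] /andP[t0 tx].
  have [gs _] := gammaP s s0 sx; have [gt _] := gammaP t t0 tx.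
  have Bst : B (gamma s) (gamma t) = C (s - t).
    have Sx2 : S x ^+ 2 != 0 by rewrite expf_neq0// gt_eqF.
    apply: (mulfI Sx2); rewrite -form_interpolation.
    have := gt p; rewrite Bpp (Bsym q p) Bpq mulr1 => gtp.
    have := gt q; rewrite Bpp Bpq mulr1 => gtq.
    by rewrite -gtp -gtq expr2 -mulrA gs (Bsym p) (Bsym q); ring.
  rewrite distE Bst -C_norm arcK//; apply: lt_dom xD.
  by rewrite ler_norml; lra.
- split; first by case: (gammaP 0 _ _) => [||_ [->]]//; apply: ltW.
  by case: (gammaP x _ _) => [||_ [_ ->]]//; apply: ltW.
- by move=> t z t0 tx; case: (gammaP t t0 tx).
Qed.

(** By the law of cosines a triangle with sides a + b, c, e exists when the
    cosine u of the angle is in [-1, 1]. The form of the point s at distance b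
    from q with the vertex r is affine in B r p = C e; if e were equal to
    a + b + c, it would be C (b + c), so that e < a + b + c gives
    surf_dist s r < b + c by the monotonicity of C. *)
Lemma constant_curvature_strict_hinges : strict_hinges M D.
Proof.
move=> a b c e a0 b0 c0 e0 tri cut abcD.
have abD : ((a + b)%:E < D)%E by apply: lt_dom abcD; lra.
have cD : (c%:E < D)%E by apply: lt_dom abcD; lra.
have eD : (e%:E < D)%E by apply: lt_dom abcD; lra.
have bcD : ((b + c)%:E < D)%E by apply: lt_dom abcD; lra.
have ab0 : 0 < a + b by lra.
have Sab := S_gt0 ab0 abD; have Sc := S_gt0 c0 cD.
have Sb : 0 < S b by apply: S_gt0 => //; apply: lt_dom abD; lra.
pose u := eps * (C e - C (a + b) * C c) / (S (a + b) * S c).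
have uE : C (a + b) * C c + eps * (S (a + b) * S c * u) = C e.
  have -> : eps * (S (a + b) * S c * u) = eps * eps * (C e - C (a + b) * C c).
    by rewrite /u; field; rewrite !gt_eqF.
  by rewrite eps2; ring.
have u1 : u ^+ 2 <= 1.
  suff /andP[? ?] : -1 <= u <= 1 by nra.
  rewrite /u ler_pdivlMr ?ler_pdivrMr ?mulr_gt0//.
  have := C_le (normr_ge0 _) tri eD; rewrite C_norm CB => le1.
  have := C_le (ltW e0) (ltW cut) abcD; rewrite CD => le2.
  have E y : eps * (eps * y) = y by rewrite mulrA eps2 mul1r.
  by rewrite mulrDr E in le1; rewrite mulrBr E in le2; rewrite mulrBr; lra.
have [p [q [r [Bpq Bqr]]]] := Bframe (a + b) c u1.
rewrite uE => Brp.
have [g1 [gg1 cg1 g1P]] := form_geodesic ab0 abD Bpq.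
have [g2 [gg2 cg2 _]] := form_geodesic c0 cD Bqr.
have [g3 [gg3 cg3 _]] := form_geodesic e0 eD Brp.
have seg x y l g : geodesic (@surf_dist R M) l g -> connects l g x y ->
  geodesic_segment (@surf_dist R M) x y (g @` `[0, l]) by exists l, g.
exists (Triangle (seg _ _ _ _ gg1 cg1) (seg _ _ _ _ gg2 cg2)
  (seg _ _ _ _ gg3 cg3)), (g1 a); split=> /=; first split.
- by rewrite distE Bpq arcK// ltW.
- by rewrite distE Bqr arcK// ltW.
- by rewrite distE Brp arcK// ltW.
have a_ab : a \in `[0, a + b] by rewrite in_itv/=; lra.
split; first by exists a.
- rewrite -cg1.1 gg1.2//; first by rewrite distrC subr0 gtr0_norm.
  by rewrite in_itv/= lexx ltW.
- rewrite distE; apply: arc_lt => //; first by lra.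
  rewrite -(ltr_pM2l Sab) mulrCA [ltRHS]mulrCA g1P; [|lra|lra].
  rewrite (Bsym p) Brp Bqr (_ : a + b - a = b); last by ring.
  have -> : S (a + b) * C (b + c) = S b * C (a + b + c) + S a * C c.
    have -> : C c = C (b + c - b) by congr C; ring.
    by rewrite CB -(addrA a) (CD a (b + c)) (SD a b); ring.
  rewrite !mulrDr ltrD2r mulrCA [ltRHS]mulrCA ltr_pM2l//.
  exact: (C_lt (ltW e0) cut abcD).
Qed.

End ConstantCurvature.

(** * Hinges in the model surfaces *)

Section Models.
Context {R : realType}.

Definition vec3 (x y z : R) : 'rV[R]_3 := \row_i [:: x; y; z]`_i.

Lemma dot3E (p q : 'rV[R]_3) :
  dot3 p q = p 0 0 * q 0 0 + p 0 1 * q 0 1 + p 0 2 * q 0 2.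
Proof.
rewrite /dot3 !big_ord_recl big_ord0 addr0 addrA.
by congr (_ + _ * _ + _ * _); [congr (p 0 _)|congr (q 0 _)|congr (p 0 _)|
  congr (q 0 _)]; apply: val_inj.
Qed.

Lemma sphere_strict_hinges (kappa : R) : 0 < kappa ->
  strict_hinges (spherical_surface kappa) (pi / Num.sqrt kappa)%:E.
Proof.
move=> kappa0; pose k := Num.sqrt kappa.
have k0 : 0 < k by rewrite sqrtr_gt0.
have dom x : ((x%:E < (pi / k)%:E)%E) = (k * x < pi).
  by rewrite lte_fin ltr_pdivlMr// mulrC.
pose B (p q : spherical_surface kappa) := dot3 (val p) (val q).
have Bpp p : B p p = 1 by apply/eqP; exact: (valP p).
have on_sphere v : dot3 v v = 1 ->
    exists p : spherical_surface kappa, val p = v.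
  by move=> /eqP v1; exists (exist (fun v => dot3 v v == 1) v v1).
have Bsym p q : B p q = B q p by rewrite /B !dot3E; ring.
apply: (@constant_curvature_strict_hinges _ _ _ 1 (fun x => cos (k * x))
  (fun x => sin (k * x)) (fun x => acos x / k) B) => //.
- by rewrite mulr1.
- by move=> x y; rewrite mulrDr cosD mul1r.
- by move=> x y; rewrite mulrDr sinD.
- by move=> x; rewrite mulrN cosN.
- by move=> x; rewrite mulrN sinN.
- by move=> x; rewrite mul1r cos2Dsin2.
- by move=> x x0; rewrite dom => xpi; rewrite sin_gt0_pi// mulr_gt0.
- move=> x y x0 xy; rewrite dom => ypi; rewrite !mul1r.
  have kxy : k * x < k * y by rewrite ltr_pM2l.
  have kx0 : 0 <= k * x by rewrite mulr_ge0// ltW.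
  by rewrite ltr_cos// in_itv/=; lra.
- move=> x x0; rewrite dom => xpi; rewrite cosK.
    by rewrite mulrC mulKf// gt_eqF.
  by rewrite in_itv/= mulr_ge0 ?(ltW xpi)// ltW.
- move=> p q y y0; rewrite dom => ypi; rewrite !mul1r => cB.
  rewrite ltr_pdivrMr// (mulrC y) ltNge; apply/negP => yB.
  have B1 : -1 <= B p q <= 1.
    apply/andP; split; first exact: le_trans (cos_geN1 _) (ltW cB).
    have := Bpp p; have := Bpp q; rewrite /B !dot3E.
    (* p and q are unit vectors, so 2 (1 - B p q) is |p - q|^2. *)
    have := sqr_ge0 (val p 0 0 - val q 0 0).
    have := sqr_ge0 (val p 0 1 - val q 0 1).
    have := sqr_ge0 (val p 0 2 - val q 0 2).
    by rewrite !expr2; lra.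
  have acosB_0pi : acos (B p q) \in `[0, pi].
    by rewrite in_itv/= acos_ge0 ?acos_lepi.
  have ky_0pi : k * y \in `[0, pi].
    by rewrite in_itv/= (ltW ypi) andbT mulr_ge0// ltW.
  by move: yB; rewrite leNgt -ltr_cos// acosK ?in_itv//= cB.
- move=> p q al be _ _ E.
  have lin z : dot3 (al *: val p + be *: val q) z =
      al * dot3 (val p) z + be * dot3 (val q) z.
    by rewrite !dot3E !mxE; ring.
  have [|r rE] := on_sphere (al *: val p + be *: val q).
    have dC u v : dot3 u v = dot3 v u :> R by rewrite !dot3E; ring.
    rewrite lin (dC (val p)) (dC (val q)) !lin.
    rewrite -/(B p p) -/(B q q) -/(B p q) -/(B q p) (Bsym q p) !Bpp -[RHS]E.
    by ring.
  by exists r => z; rewrite /B rE lin.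
- move=> x y u u1; pose v := Num.sqrt (1 - u ^+ 2).
  have v2 : v ^+ 2 = 1 - u ^+ 2 by rewrite sqr_sqrtr// subr_ge0.
  have [|p pE] := on_sphere (vec3 (cos (k * x)) (sin (k * x)) 0).
    by rewrite dot3E !mxE/= -(cos2Dsin2 (k * x)); ring.
  have [|q qE] := on_sphere (vec3 1 0 0).
    by rewrite dot3E !mxE/=; ring.
  have [|r rE] := on_sphere
      (vec3 (cos (k * y)) (sin (k * y) * u) (sin (k * y) * v)).
    rewrite dot3E !mxE/= -(cos2Dsin2 (k * y)).
    have -> : sin (k * y) ^+ 2 = sin (k * y) ^+ 2 * (u ^+ 2 + v ^+ 2).
      by rewrite v2; ring.
    by ring.
  exists p, q, r.
  by rewrite /B pE qE rE !dot3E !mxE/=; split; ring.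
Qed.

Definition cosh (x : R) : R := (expR x + expR (- x)) / 2.
Definition sinh (x : R) : R := (expR x - expR (- x)) / 2.

Lemma coshD x y : cosh (x + y) = cosh x * cosh y + sinh x * sinh y.
Proof. by rewrite /cosh /sinh opprD !expRD; field. Qed.

Lemma sinhD x y : sinh (x + y) = sinh x * cosh y + cosh x * sinh y.
Proof. by rewrite /cosh /sinh opprD !expRD; field. Qed.

Lemma coshN x : cosh (- x) = cosh x.
Proof. by rewrite /cosh opprK addrC. Qed.

Lemma sinhN x : sinh (- x) = - sinh x.
Proof. by rewrite /sinh opprK; field. Qed.

Lemma cosh2Bsinh2 x : cosh x ^+ 2 - sinh x ^+ 2 = 1.
Proof.
rewrite /cosh /sinh -[RHS](mulfV (lt0r_neq0 (expR_gt0 x))) -expRN.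
by field.
Qed.

Lemma sinh_gt0 x : 0 < x -> 0 < sinh x.
Proof. by move=> x0; rewrite divr_gt0// subr_gt0 ltr_expR; lra. Qed.

Lemma cosh_gt0 x : 0 < cosh x.
Proof. by rewrite divr_gt0// addr_gt0 ?expR_gt0. Qed.

(** cosh y - cosh x = 2 sinh ((y + x) / 2) sinh ((y - x) / 2). *)
Lemma ltr_cosh x y : 0 <= x -> x < y -> cosh x < cosh y.
Proof.
move=> x0 xy.
have s1 : 0 < sinh ((y - x) / 2) by apply: sinh_gt0; lra.
have s2 : 0 < sinh ((y + x) / 2) by apply: sinh_gt0; lra.
have -> : y = (y + x) / 2 + (y - x) / 2 by field.
have {1}-> : x = (y + x) / 2 - (y - x) / 2 by field.
rewrite (coshD _ (- _)) coshD coshN sinhN; nra.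
Qed.

Lemma coshK x : 0 <= x -> arcosh (cosh x) = x.
Proof.
move=> x0; rewrite /arcosh.
have -> : cosh x ^+ 2 - 1 = sinh x ^+ 2.
  by have := cosh2Bsinh2 x; lra.
have sx : 0 <= sinh x.
  by rewrite divr_ge0// subr_ge0 ler_expR; lra.
rewrite sqrtr_sqr ger0_norm// (_ : _ + _ = expR x) ?expRK//.
by rewrite /cosh /sinh; field.
Qed.

(** For x < 1, where the formula defining [arcosh] is no inverse of [cosh], its
    value is nonpositive. *)
Lemma arcosh_lt x y : 0 < y -> x < cosh y -> arcosh x < y.
Proof.
move=> y0 xy; rewrite /arcosh; have [x1|x1] := leP 1 x; last first.
  suff /ln_le0 : x + Num.sqrt (x ^+ 2 - 1) <= 1 by lra.
  rewrite -lerBrDl -(ger0_norm (_ : 0 <= 1 - x)) ?subr_ge0 ?(ltW x1)//.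
  by rewrite -sqrtr_sqr ler_wsqrtr//; nra.
have s0 := sinh_gt0 y0.
have lt_sqrt : Num.sqrt (x ^+ 2 - 1) < sinh y.
  rewrite -(gtr0_norm s0) -sqrtr_sqr ltr_sqrt ?exprn_gt0//.
  by have := cosh2Bsinh2 y; nra.
have := sqrtr_ge0 (x ^+ 2 - 1) => sq0.
rewrite -ltr_expR lnK ?qualifE/=; last by lra.
by have : expR y = cosh y + sinh y by [rewrite /cosh /sinh; field]; lra.
Qed.

Lemma hyperbolic_strict_hinges (kappa : R) : kappa < 0 ->
  strict_hinges (hyperbolic_surface kappa) +oo%E.
Proof.
move=> kappa0; pose k := Num.sqrt (- kappa).
have k0 : 0 < k by rewrite sqrtr_gt0 oppr_gt0.
pose B (p q : hyperbolic_surface kappa) := - lorentz3 (val p) (val q).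
have Bpp p : B p p = 1.
  by rewrite /B; have /andP[/eqP -> _] := valP p; rewrite opprK.
have on_sheet v : lorentz3 v v = -1 -> 0 < v 0 0 ->
    exists p : hyperbolic_surface kappa, val p = v.
  move=> /eqP v1 v0; have vP : (lorentz3 v v == -1) && (0 < v 0 0).
    by rewrite v1.
  by exists (exist (fun v => (lorentz3 v v == -1) && (0 < v 0 0)) v vP).
have Bsym p q : B p q = B q p by rewrite /B /lorentz3; ring.
apply: (@constant_curvature_strict_hinges _ _ _ (-1) (fun x => cosh (k * x))
  (fun x => sinh (k * x)) (fun x => arcosh x / k) B) => //.
- by ring.
- by move=> x y; rewrite mulrDr coshD mulN1r opprK.
- by move=> x y; rewrite mulrDr sinhD.
- by move=> x; rewrite mulrN coshN.
- by move=> x; rewrite mulrN sinhN.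
- by move=> x; rewrite mulN1r cosh2Bsinh2.
- by move=> x x0 _; rewrite sinh_gt0// mulr_gt0.
- move=> x y x0 xy _; rewrite !mulN1r ltrN2 ltr_cosh ?ltr_pM2l//.
  by rewrite mulr_ge0// ltW.
- move=> x x0 _; rewrite coshK; first by rewrite mulrC mulKf// gt_eqF.
  by rewrite mulr_ge0// ltW.
- move=> p q y y0 _; rewrite !mulN1r ltrN2 => cB.
  by rewrite ltr_pdivrMr// (mulrC y) arcosh_lt// mulr_gt0.
- move=> p q al be al0 be0 E.
  have lin z : lorentz3 (al *: val p + be *: val q) z =
      al * lorentz3 (val p) z + be * lorentz3 (val q) z.
    by rewrite /lorentz3 !mxE; ring.
  have [||r rE] := on_sheet (al *: val p + be *: val q).
  - have dC u v : lorentz3 u v = lorentz3 v u :> R by rewrite /lorentz3; ring.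
    rewrite lin (dC (val p)) (dC (val q)) !lin.
    have BE u v : lorentz3 (val u) (val v) = - B u v by rewrite opprK.
    by rewrite !BE (Bsym q p) !Bpp -[in RHS]E; ring.
  - rewrite !mxE; have /andP[_ p0] := valP p; have /andP[_ q0] := valP q.
    have [al_gt0|al_le0] := ltP 0 al.
      by rewrite ltr_pwDl ?mulr_gt0// mulr_ge0// ltW.
    have al_eq0 : al = 0 by lra.
    rewrite al_eq0 mul0r add0r mulr_gt0// lt0r be0 andbT; apply/eqP => be_eq0.
    by move: E; rewrite al_eq0 be_eq0; lra.
  - by exists r => z; rewrite /B rE lin; ring.
- move=> x y u u1; pose v := Num.sqrt (1 - u ^+ 2).
  have v2 : v ^+ 2 = 1 - u ^+ 2 by rewrite sqr_sqrtr// subr_ge0.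
  have mk a b c : 0 < a -> a ^+ 2 - b ^+ 2 - c ^+ 2 = 1 ->
      exists p : hyperbolic_surface kappa, val p = vec3 a b c.
    by move=> a0 E; apply: on_sheet; rewrite /lorentz3 !mxE/= // -E; ring.
  have [|p pE] := mk _ (sinh (k * x)) 0 (cosh_gt0 (k * x)).
    by rewrite -(cosh2Bsinh2 (k * x)); ring.
  have [|q qE] := mk 1 0 0 ltr01; first by ring.
  have [|r rE] := mk _ (sinh (k * y) * u) (sinh (k * y) * v) (cosh_gt0 (k * y)).
    by rewrite [X in _ - X]exprMn v2 -[RHS](cosh2Bsinh2 (k * y)); ring.
  exists p, q, r.
  by rewrite /B pE qE rE /lorentz3 !mxE/=; split; ring.
Qed.

Definition vec2 (x y : R) : 'rV[R]_2 := \row_i [:: x; y]`_i.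

Lemma euclidean_distE (p q : 'rV[R]_2) :
  @surf_dist R (euclidean_plane) p q =
  Num.sqrt ((p 0 0 - q 0 0) ^+ 2 + (p 0 1 - q 0 1) ^+ 2).
Proof.
rewrite /= !big_ord_recl big_ord0 addr0.
by rewrite (_ : lift ord0 ord0 = 1) //; apply: val_inj.
Qed.

Lemma euclidean_geodesic (p q : euclidean_plane) (x : R) :
  0 < x -> surf_dist p q = x ->
  let gamma := fun t => (p : 'rV[R]_2) + (t / x) *: ((q : 'rV[R]_2) - p) in
  geodesic (@surf_dist R euclidean_plane) x gamma /\ connects x gamma p q.
Proof.
move=> x0 pq gamma; split; last first.
  split; rewrite /gamma; first by rewrite mul0r scale0r addr0.
  by rewrite divff ?gt_eqF// scale1r addrC subrK.
split; first exact: ltW.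
move=> s t _ _; rewrite euclidean_distE /gamma !mxE.
set d0 := q 0 0 - p 0 0; set d1 := q 0 1 - p 0 1.
have dx : d0 ^+ 2 + d1 ^+ 2 = x ^+ 2.
  rewrite -pq euclidean_distE sqr_sqrtr ?addr_ge0 ?sqr_ge0//.
  by rewrite /d0 /d1; ring.
rewrite -sqrtr_sqr; congr Num.sqrt.
transitivity ((s - t) ^+ 2 / x ^+ 2 * (d0 ^+ 2 + d1 ^+ 2)).
  by field; rewrite gt_eqF.
by rewrite dx divfK// expf_neq0// gt_eqF.
Qed.

Lemma euclidean_strict_hinges : strict_hinges (@euclidean_plane R) +oo%E.
Proof.
move=> a b c e a0 b0 c0 e0 tri cut _.
pose x := a + b; have x0 : 0 < x by rewrite addr_gt0.
pose u := (x ^+ 2 + c ^+ 2 - e ^+ 2) / (2 * (x * c)).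
have xc0 : 0 < 2 * (x * c) by rewrite !mulr_gt0.
move: tri cut; rewrite -/x ler_norml => /andP[tri1 tri2] cut.
(* u is the cosine of the angle between the sides of lengths x and c. *)
have uE : e ^+ 2 = x ^+ 2 + c ^+ 2 - 2 * (x * c) * u.
  by rewrite /u; field; rewrite !gt_eqF.
have u_gtN1 : -1 < u by rewrite /u ltr_pdivlMr//; nra.
have u_le1 : u <= 1 by rewrite /u ler_pdivrMr//; nra.
pose v := Num.sqrt (1 - u ^+ 2).
have v2 : v ^+ 2 = 1 - u ^+ 2 by rewrite sqr_sqrtr//; nra.
pose p : euclidean_plane := vec2 x 0.
pose q : euclidean_plane := vec2 0 0.
pose r : euclidean_plane := vec2 (c * u) (c * v).
have sqrtE l y : 0 < l -> y = l ^+ 2 -> Num.sqrt y = l.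
  by move=> l0 ->; rewrite sqrtr_sqr gtr0_norm.
have dpq : surf_dist p q = x.
  by rewrite euclidean_distE !mxE/=; apply: sqrtE => //; ring.
have dqr : surf_dist q r = c.
  rewrite euclidean_distE !mxE/=; apply: sqrtE => //.
  transitivity (c ^+ 2 * (u ^+ 2 + v ^+ 2)); first by ring.
  by rewrite v2; ring.
have drp : surf_dist r p = e.
  rewrite euclidean_distE !mxE/=; apply: sqrtE => //.
  transitivity (x ^+ 2 - 2 * (x * c) * u + c ^+ 2 * (u ^+ 2 + v ^+ 2)).
    by ring.
  by rewrite v2 uE; ring.
have [gg1 cg1] := euclidean_geodesic x0 dpq.
have [gg2 cg2] := euclidean_geodesic c0 dqr.
have [gg3 cg3] := euclidean_geodesic e0 drp.
have seg y z l g : geodesic (@surf_dist R euclidean_plane) l g ->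
  connects l g y z -> geodesic_segment (@surf_dist R euclidean_plane) y z
  (g @` `[0, l]) by exists l, g.
exists (Triangle (seg _ _ _ _ gg1 cg1) (seg _ _ _ _ gg2 cg2)
  (seg _ _ _ _ gg3 cg3)), (vec2 b 0 : euclidean_plane).
split; first by split.
split.
- exists a; first by rewrite /= in_itv/= ltW//= lerDl ltW.
  apply/rowP => i; rewrite !mxE; have xE : x - a = b by rewrite /x; ring.
  case: i => -[|[|//]] /= _; last by ring.
  by rewrite -xE; field; rewrite gt_eqF.
- by rewrite /vtxa euclidean_distE !mxE/=; apply: sqrtE => //; rewrite /x; ring.
- rewrite /vtxc euclidean_distE !mxE/=.
  have bc : 0 < b + c by lra.
  rewrite -[ltRHS](gtr0_norm bc) -sqrtr_sqr ltr_sqrt ?exprn_gt0//.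
  have -> : (b - c * u) ^+ 2 + (0 - c * v) ^+ 2 =
    b ^+ 2 - 2 * (b * c) * u + c ^+ 2 * (u ^+ 2 + v ^+ 2) by ring.
  have := mulr_gt0 b0 c0; rewrite v2 => bc0; nra.
Qed.

Lemma surface_strict_hinges (kappa : R) :
  strict_hinges (surface kappa) (diam_surface kappa).
Proof.
rewrite /surface /diam_surface; case: ifP => [k0|_].
  exact: sphere_strict_hinges.
case: ifP => [k0|_]; first exact: hyperbolic_strict_hinges.
exact: euclidean_strict_hinges.
Qed.

End Models.

Theorem theorem4p5 (R : realType) (kappa : R) (X : metricType R)
    (X_geodesic : geodesic_space (@mdist R X)) (X_CAT : CAT X kappa) :
  (diam_surface kappa <= m_inf X /\ m_inf X <= l_inf X)%E.
Proof.
split; last exact: m_inf_le_l_inf.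
apply: strict_hinges_le_m_inf => //; exact: surface_strict_hinges.
Qed.
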